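(* Let $F$ be the function on $Q=[-\pi,\pi]^2$ given by the Fourier series $$F(\tau)=-\sum_{m\in\mathbb{Z}^2,\,m\neq0}\frac{m_1m_2}{\pi|m|^4}\,e^{im\cdot\tau}=\frac4\pi\sum_{m_1,m_2=1}^\infty\frac{m_1m_2}{(m_1^2+m_2^2)^2}\sin(m_1\tau_1)\sin(m_2\tau_2).$$ Then for any $\tau\in Q$, $$F(\tau)\in\left[-\tfrac12,\tfrac12\right].$$
   Context: The Fourier series is not absolutely convergent; it converges in $L^2(Q)$, and $F$ denotes the representative of the sum that is continuous on $Q\setminus\{0\}$ (such a representative exists), with $F(0)=0$. *)

(* Defs.v *)
From HB Require Import structures.
From mathcomp Require Import all_boot all_order all_algebra finmap complex.
From mathcomp Require Import all_classical all_reals all_analysis.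
From mathcomp.analysis Require Import showcase.summability.
Set Implicit Arguments.
Unset Strict Implicit.
Unset Printing Implicit Defensive.
Import Order.TTheory GRing.Theory Num.Theory.
Import numFieldNormedType.Exports.
Import ComplexField.Normc.
Local Open Scope classical_set_scope.
Local Open Scope complex_scope.
Local Open Scope ring_scope.

Definition square (R : realType) : set (R * R) :=
  `[- pi, pi] `*` `[- pi, pi].
Arguments square : clear implicits.

Definition lebesgue2 (R : realType) :
    {measure set (measurableTypeR R * measurableTypeR R) -> \bar R} :=
  (@lebesgue_measure R \x @lebesgue_measure R)%E.

Definition L2dist (R : realType) (f g : R * R -> R[i]) : \bar R :=
  Lnorm (lebesgue2 R) 2%:E
    ((fun t : R * R => (normc (f t - g t))%:E) \_ (square R)).

(* [S A] is the sum of the terms of a series whose index lies in the finite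
   set [A]; convergence is along the finite sets ordered by inclusion, so no
   order of summation is singled out. *)
Definition L2_sums_to (R : realType) (I : choiceType)
    (S : {fset I} -> R * R -> R[i]) (f : R * R -> R[i]) : Prop :=
  L2dist (S A) f @[A --> totally] --> 0%E.

Definition expi (R : realType) (x : R) : R[i] := cos x +i* sin x.

Definition exp_partial_sum (R : realType) (A : {fset int * int})
    (t : R * R) : R[i] :=
  - \sum_(m <- A | m != (0, 0))
      ((m.1%:~R * m.2%:~R) / (pi * (m.1%:~R ^+ 2 + m.2%:~R ^+ 2) ^+ 2))%:C
      * expi (m.1%:~R * t.1 + m.2%:~R * t.2).

Definition sin_partial_sum (R : realType) (A : {fset nat * nat})
    (t : R * R) : R :=
  4 / pi * \sum_(m <- A | (0 < m.1)%N && (0 < m.2)%N)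
      (m.1%:R * m.2%:R) / (m.1%:R ^+ 2 + m.2%:R ^+ 2) ^+ 2
      * sin (m.1%:R * t.1) * sin (m.2%:R * t.2).

(* The values of [F] off [square R] are irrelevant. *)
Definition continuous_representative (R : realType) (F : R * R -> R) : Prop :=
  [/\ L2_sums_to (@exp_partial_sum R) (fun t => (F t)%:C),
      {within square R `\ (0, 0), continuous F}
    & F (0, 0) = 0].

(* Main.v *)
Require Import Defs.
From HB Require Import structures.
From mathcomp Require Import all_boot all_order all_algebra finmap complex ring lra zify.
From mathcomp Require Import all_classical all_reals all_analysis.
From mathcomp.analysis Require Import showcase.summability.
Import Order.TTheory GRing.Theory Num.Theory.
Import numFieldNormedType.Exports.
Local Open Scope classical_set_scope.
Local Open Scope complex_scope.
Local Open Scope ring_scope.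
(* For each n, the inner sum over m of F can be evaluated: on [0, pi],
     sum_m m sin(m x) / (m^2 + n^2)^2 = pi / (4 n) * psi_n(x),
   where psi_n(x) = x e^{-n x} + rho_n(x). No Fourier inversion is needed: the
   partial sums solve u'' = n^2 u + h_M with explicit boundary values, h_M is
   controlled away from 0 by the sawtooth series, and the maximum principle
   turns this into uniform convergence.
   The terms x e^{-n x} sum to x sin y / (2 (cosh x - cos y)), which lies in
   [0, 1/2] for x > 0 and y in [0, pi], while sum_n rho_n(x) sin(n y) lies in
   [-1/2, 0] because its first term dominates the others. Hence, for x bounded
   away from 0, the rectangular partial sums of the double sine series are
   eventually within any e > 0 of [-1/2, 1/2]. If |F| exceeded 1/2 at some
   point, it would do so by a fixed amount on a small box away from x = 0, which
   contradicts L^2 convergence; in this way neither an almost everywhere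
   argument nor the measurability of F is used. *)

Set Implicit Arguments.
Unset Strict Implicit.

(** * Derivatives and the maximum principle *)

Section PointwiseDerivation.
Variables (R : realType) (x : R).
Implicit Types (f g : R -> R) (a b : R).

(** The differentiation rules are stated for explicit lambdas, so that they apply by the shape of a
    formula and leave the derivative to [ring] or [field]. *)
Lemma derive_cst_fun a : is_derive x 1 (fun _ : R => a) 0.
Proof. exact: is_derive_cst. Qed.

Lemma derive_id_fun : is_derive x 1 (fun t : R => t) 1.
Proof. exact: is_derive_id. Qed.

Lemma derive_add_fun f g a b : is_derive x 1 f a -> is_derive x 1 g b ->
  is_derive x 1 (fun t => f t + g t) (a + b).
Proof. by move=> df dg; apply: is_deriveD. Qed.

Lemma derive_opp_fun f a :
  is_derive x 1 f a -> is_derive x 1 (fun t => - f t) (- a).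
Proof. by move=> df; apply: is_deriveN. Qed.

Lemma derive_mul_fun f g a b : is_derive x 1 f a -> is_derive x 1 g b ->
  is_derive x 1 (fun t => f t * g t) (a * g x + f x * b).
Proof.
move=> df dg; apply: (is_derive_eq (is_deriveM df dg)).
by rewrite addrC [in LHS]/GRing.scale/= mulrC.
Qed.

Lemma derive_inv_fun f a : f x != 0 -> is_derive x 1 f a ->
  is_derive x 1 (fun t => (f t)^-1) (- a / f x ^+ 2).
Proof.
move=> fx [dvf <-]; apply: DeriveDef; first exact: derivableV.
by rewrite deriveV// /GRing.scale/= mulNr mulrC mulNr.
Qed.

Lemma derive_sin_fun f a : is_derive x 1 f a ->
  is_derive x 1 (fun t => sin (f t)) (a * cos (f x)).
Proof. by move=> df; rewrite mulrC; apply: is_derive1_comp. Qed.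

Lemma derive_cos_fun f a : is_derive x 1 f a ->
  is_derive x 1 (fun t => cos (f t)) (- a * sin (f x)).
Proof. by move=> df; rewrite mulNr mulrC -mulNr; apply: is_derive1_comp. Qed.

Lemma derive_expR_fun f a : is_derive x 1 f a ->
  is_derive x 1 (fun t => expR (f t)) (a * expR (f x)).
Proof. by move=> df; rewrite mulrC; apply: is_derive1_comp. Qed.

Lemma derive_sum_fun n (f : nat -> R -> R) (a : nat -> R) :
  (forall k, (0 < k)%N -> is_derive x 1 (f k) (a k)) ->
  is_derive x 1 (fun t => \sum_(1 <= k < n.+1) f k t) (\sum_(1 <= k < n.+1) a k).
Proof.
move=> df; elim: n => [|n IH].
  rewrite (_ : (fun _ => _) = fun=> 0); last by apply/funext => t; rewrite big_geq.
  by rewrite big_geq//; exact: derive_cst_fun.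
rewrite big_nat_recr//= (_ : (fun _ => _) =
    fun t => \sum_(1 <= k < n.+1) f k t + f n.+1 t); last first.
  by apply/funext => t; rewrite big_nat_recr.
by apply: derive_add_fun => //; exact: df.
Qed.

End PointwiseDerivation.

(* [apply:] would let typeclass resolution guess the derivatives of the parts. *)
Ltac derive_step := first
  [ notypeclasses refine (derive_cst_fun _ _)
  | notypeclasses refine (derive_id_fun _)
  | notypeclasses refine (derive_opp_fun _)
  | notypeclasses refine (derive_sin_fun _)
  | notypeclasses refine (derive_cos_fun _)
  | notypeclasses refine (derive_expR_fun _)
  | notypeclasses refine (derive_add_fun _ _)
  | notypeclasses refine (derive_mul_fun _ _) ].
Ltac derive_eq := notypeclasses refine (is_derive_eq _ _).
Ltac derive_tac := derive_eq; [repeat derive_step|rewrite /=].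

Section MeanValue.
Variables (R : realType).
Implicit Types (f : R -> R) (a b : R).

Lemma is_derive_within f (f' : R -> R) a b :
  (forall t, a <= t <= b -> is_derive t 1 f (f' t)) ->
  {within `[a, b], continuous f}.
Proof.
move=> df; apply: derivable_within_continuous => t.
by rewrite in_itv => /= tab; case: (df t tab).
Qed.

Lemma mean_value f f' a b : a <= b ->
  (forall t, a <= t <= b -> is_derive t 1 f (f' t)) ->
  exists2 c, a <= c <= b & f b - f a = f' c * (b - a).
Proof.
rewrite le_eqVlt => /predU1P[->|ab] df.
  by exists b; [rewrite lexx|rewrite !subrr mulr0].
have [t||c] := @MVT R f f' a b ab.
- by rewrite in_itv/= => /andP[/ltW ta /ltW tb]; apply: df; rewrite ta.
- exact: is_derive_within df.
by rewrite in_itv/= => /andP[ac cb] ->; exists c; rewrite // !ltW.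
Qed.

Lemma mean_value_bound f f' a b K : a <= b ->
  (forall t, a <= t <= b -> is_derive t 1 f (f' t)) ->
  (forall t, a <= t <= b -> `|f' t| <= K) -> `|f b - f a| <= K * (b - a).
Proof.
move=> ab df f'K; have [c cab ->] := mean_value ab df.
rewrite normrM (ger0_norm (_ : 0 <= b - a)) ?subr_ge0//.
by rewrite ler_wpM2r ?subr_ge0// f'K.
Qed.

Lemma nondecreasing_derive f f' a b : a <= b ->
  (forall t, a <= t <= b -> is_derive t 1 f (f' t)) ->
  (forall t, a <= t <= b -> 0 <= f' t) -> f a <= f b.
Proof.
move=> ab df f'0; have [c cab fab] := mean_value ab df.
by rewrite -subr_ge0 fab mulr_ge0 ?subr_ge0 ?f'0.
Qed.

End MeanValue.

Section MaximumPrinciple.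
Variable R : realType.

(** If the maximum exceeded [K], it would be attained at an interior point [x0], where [w1]
    vanishes. Just to the right of [x0], [w] is still above [K], so [w2] is positive, [w1] becomes
    positive, and [w] climbs above its maximum. *)
Lemma max_principle (w w1 w2 : R -> R) (c d a K : R) : c <= d -> 0 < a ->
  (forall t, c <= t <= d -> is_derive t 1 w (w1 t)) ->
  (forall t, c <= t <= d -> is_derive t 1 w1 (w2 t)) ->
  (forall t, c <= t <= d -> a ^+ 2 * (w t - K) <= w2 t) ->
  w c <= K -> w d <= K -> forall t, c <= t <= d -> w t <= K.
Proof.
move=> cd a0 dw dw1 w2K wc wd t tcd.
have [x0 x0I wmax] := EVT_max cd (is_derive_within dw).
have {}wmax s : c <= s <= d -> w s <= w x0 by move=> h; apply: wmax; rewrite in_itv.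
move: x0I; rewrite in_itv/= => /andP[cx0 x0d].
apply: (le_trans (wmax t tcd)); rewrite leNgt; apply/negP => Kw.
have cx : c < x0.
  by rewrite lt_neqAle cx0 andbT; apply: contraTneq Kw => <-; rewrite -leNgt.
have xd : x0 < d.
  by rewrite lt_neqAle x0d andbT; apply: contraTneq Kw => ->; rewrite -leNgt.
have w10 : w1 x0 = 0.
  have dx0 : is_derive x0 1 w (w1 x0) by apply: dw; rewrite !ltW.
  have [s|||_ <-] := @derive1_at_max R w c d x0 cd.
  - by rewrite in_itv/= => /andP[/ltW h1 /ltW h2]; case: (dw s); rewrite ?h1.
  - by rewrite in_itv/= cx.
  - by move=> s; rewrite in_itv/= => /andP[/ltW h1 /ltW h2]; apply: wmax; rewrite h1.
  - by case: dx0 => _ <-.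
have cw : {for x0, continuous w}.
  apply/differentiable_continuous/derivable1_diffP.
  by case: (dw x0); rewrite // !ltW.
have /nbhs_ballP[e /= e0 we] : \forall s \near x0, K < w s.
  exact: (cvgr_gt (w x0) cw).
pose r := Num.min (e / 2) (d - x0).
have r0 : 0 < r by rewrite lt_min subr_gt0 xd divr_gt0.
have rd : r <= d - x0 by rewrite ge_min lexx orbT.
have re : r <= e / 2 by rewrite ge_min lexx.
have wK s : x0 <= s <= x0 + r -> K < w s.
  move=> /andP[h1 h2]; apply: we; rewrite /ball/= ltr_distl; lra.
have w1_ge0 s : x0 <= s <= x0 + r -> 0 <= w1 s.
  move=> /andP[h1 h2]; rewrite -w10.
  apply: (nondecreasing_derive (f' := w2) h1) => u /andP[u1 u2].
    by apply: dw1; lra.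
  apply: le_trans (w2K u _); last by lra.
  by rewrite mulr_ge0 ?sqr_ge0// subr_ge0 ltW// wK; lra.
(* The half-way point separates two uses of [w1]: on the first half it is only known to be
   nonnegative, while from [x0 + r / 2] on it is strictly positive, so [w (x0 + r)] exceeds
   [w x0]. *)
have rh : x0 <= x0 + r / 2 <= x0 + r by lra.
have [||z /andP[z1 z2]] := @mean_value R w1 w2 x0 (x0 + r / 2); [lra| |].
  by move=> s sI; apply: dw1; lra.
rewrite w10 subr0 => w1h.
have w1_gt0 : 0 < w1 (x0 + r / 2).
  rewrite w1h mulr_gt0//; last by lra.
  apply: lt_le_trans (w2K z _); last by lra.
  by rewrite mulr_gt0 ?exprn_gt0// subr_gt0 wK//; lra.
have [||y /andP[y1 y2] wy] := @mean_value R w w1 (x0 + r / 2) (x0 + r); [lra| |].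
  by move=> s sI; apply: dw; lra.
have w1y : 0 < w1 y.
  apply: lt_le_trans w1_gt0 _.
  apply: (nondecreasing_derive (f' := w2) y1) => q /andP[q1 q2].
    by apply: dw1; lra.
  apply: le_trans (w2K q _); last by lra.
  by rewrite mulr_ge0 ?sqr_ge0// subr_ge0 ltW// wK; lra.
have : w x0 <= w (x0 + r / 2).
  apply: (nondecreasing_derive (f' := w1)) => [|s /andP[s1 s2]|s /andP[s1 s2]].
  - by lra.
  - by apply: dw; lra.
  - by apply: w1_ge0; lra.
have : 0 < w1 y * (x0 + r - (x0 + r / 2)) by rewrite mulr_gt0//; lra.
by rewrite -wy => h1 h2; have := wmax (x0 + r); lra.
Qed.

End MaximumPrinciple.

(** * Convergence through boundary value problems *)

Definition uniformly_tends (R : realType) (c d : R) (u : nat -> R -> R)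
    (v : R -> R) : Prop :=
  forall e, 0 < e -> exists M0, forall M, (M0 <= M)%N ->
  forall x, c <= x <= d -> `|u M x - v x| <= e.

Section BoundaryValueProblem.
Variable R : realType.

(* The hypothesis [|u M x| <= C * x] replaces uniform convergence of the right
   hand sides near 0, where it fails. *)
Lemma bvp_uniformly_tends (a b C : R) (u u1 h : nat -> R -> R)
    (v v1 k : R -> R) : 0 < a -> 0 < b -> 0 <= C ->
  (forall M (x : R), is_derive x 1 (u M) (u1 M x)) ->
  (forall M (x : R), is_derive x 1 (u1 M) (a ^+ 2 * u M x + h M x)) ->
  (forall x : R, is_derive x 1 v (v1 x)) ->
  (forall x : R, is_derive x 1 v1 (a ^+ 2 * v x + k x)) ->
  (forall M x, 0 <= x <= b -> `|u M x| <= C * x) -> v 0 = 0 ->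
  (forall M, u M b = v b) ->
  (forall c, 0 < c -> uniformly_tends c b h k) ->
  uniformly_tends 0 b u v.
Proof.
move=> a0 b0 C0 du du1 dv dv1 uC v0 ub hk e e0.
have [r /= r0 vr] : exists2 r, 0 < r & forall x, 0 <= x < r -> `|v x| <= e / 2.
  have cv : v x @[x --> (0 : R)] --> v 0.
    by apply/differentiable_continuous/derivable1_diffP; case: (dv 0).
  have /nbhs_ballP[r /= r0 vr] : \forall x \near (0 : R), `|v 0 - v x| <= e / 2.
    by move/cvgr_dist_le: cv; apply; rewrite divr_gt0.
  exists r => // x /andP[x0 xr].
  have : ball (0 : R) r x by rewrite /ball/= sub0r normrN ger0_norm.
  by move=> /vr /=; rewrite v0 sub0r normrN.
(* On [[0, c]] both [u M] and [v] are at most [e / 2] in absolute value; dividing by [C + 1] covers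
   the case [C = 0]. *)
pose c := Num.min (Num.min (r / 2) b) (e / 2 / (C + 1)).
have C1 : 0 < C + 1 by lra.
have c0 : 0 < c by rewrite !lt_min !divr_gt0 ?b0.
have cb : c <= b by rewrite /c !ge_min lexx orbT.
have cr : c <= r / 2 by rewrite /c !ge_min lexx.
have cC : C * c <= e / 2.
  apply: le_trans (_ : (C + 1) * c <= _); first by rewrite ler_wpM2r ?lerDl ?ltW.
  by rewrite mulrC -ler_pdivlMr// /c !ge_min lexx orbT.
have near0 M x : 0 <= x <= c -> `|u M x - v x| <= e.
  move=> /andP[x0 xc]; apply: le_trans (ler_normB _ _) _.
  have h1 : `|u M x| <= C * x by apply: uC; lra.
  have h2 : `|v x| <= e / 2 by apply: vr; lra.
  have h3 : C * x <= C * c by rewrite ler_wpM2l.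
  lra.
(* With this tolerance the difference [w] of [u M] and [v] satisfies w'' >= a^2 (w - e) on [[c, b]],
   for either sign of the difference, which is the hypothesis of [max_principle] with [K = e]. *)
have [M0 hM0] := hk c c0 (a ^+ 2 * e) (mulr_gt0 (exprn_gt0 2 a0) e0).
exists M0 => M MM x /andP[x0 xb].
have [xc|cx] := leP x c; first by apply: near0; rewrite x0.
have {}hM t : c <= t <= b -> `|h M t - k t| <= a ^+ 2 * e by exact: hM0.
have cc : `|u M c - v c| <= e by apply: near0; rewrite lexx ltW.
have xI : c <= x <= b by rewrite xb ltW.
rewrite ler_norml; apply/andP; split.
  rewrite lerNl opprB.
  apply: (@max_principle R (fun t => v t - u M t) (fun t => v1 t - u1 M t)
    (fun t => (a ^+ 2 * v t + k t) - (a ^+ 2 * u M t + h M t)) c b a e) => //.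
  - by move=> t /hM; rewrite ler_norml => /andP[]; lra.
  - by move: cc; rewrite ler_norml; lra.
  - by rewrite ub subrr ltW.
apply: (@max_principle R (fun t => u M t - v t) (fun t => u1 M t - v1 t)
    (fun t => (a ^+ 2 * u M t + h M t) - (a ^+ 2 * v t + k t)) c b a e) => //.
- by move=> t /hM; rewrite ler_norml => /andP[]; lra.
- by move: cc; rewrite ler_norml; lra.
- by rewrite ub subrr ltW.
Qed.

End BoundaryValueProblem.

(** * Uniform convergence of the sawtooth series away from 0 *)

Section Sawtooth.
Variable R : realType.

(** Since the sine series sums to (pi - x) / 2 on (0, 2 pi), adding [x / 2] makes the limit constant
    and the derivative a Dirichlet kernel. *)
Definition sawtooth (M : nat) (x : R) : R :=
  x / 2 + \sum_(1 <= m < M.+1) sin (m%:R * x) / m%:R.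

Definition dirichlet (M : nat) (x : R) : R :=
  2^-1 + \sum_(1 <= m < M.+1) cos (m%:R * x).

(** The sum telescopes: 2 sin(x/2) cos(m x) = sin((m + 1/2) x) - sin((m - 1/2) x). *)
Lemma dirichletE M x :
  2 * sin (x / 2) * dirichlet M x = sin ((M%:R + 2^-1) * x).
Proof.
rewrite /dirichlet; elim: M => [|M IH].
  by rewrite big_geq// addr0 mulrAC divff ?pnatr_eq0// mul1r add0r mulrC.
rewrite big_nat_recr//= addrA mulrDr IH.
have -> : (M%:R + 2^-1) * x = M.+1%:R * x - x / 2 by rewrite -natr1; field.
have -> : (M.+1%:R + 2^-1) * x = M.+1%:R * x + x / 2 by field.
by rewrite sinB sinD; ring.
Qed.

Lemma is_derive_sawtooth M (x : R) : is_derive x 1 (sawtooth M) (dirichlet M x).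
Proof.
apply: derive_add_fun; first by derive_tac; ring.
apply: (@derive_sum_fun R x M (fun m t => sin (m%:R * t) / m%:R)
  (fun m => cos (m%:R * x))) => m m0; derive_tac.
by field; rewrite pnatr_eq0 -lt0n.
Qed.

Lemma sin_natmul_pi m : sin (m%:R * pi) = 0 :> R.
Proof.
elim: m => [|m IH]; first by rewrite mul0r sin0.
by rewrite -natr1 mulrDl mul1r sinD IH sinpi mul0r mulr0 addr0.
Qed.

Lemma sawtooth_pi M : sawtooth M pi = pi / 2.
Proof.
by rewrite /sawtooth big1 ?addr0// => m _; rewrite sin_natmul_pi mul0r.
Qed.

(** The value at [pi] is exact, and the difference between [x] and [pi] is the integral of the
    Dirichlet kernel, which one integration by parts shows to be O(1/M) as long as sin(x/2) stays
    away from 0. *)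
Lemma sawtooth_uniformly_tends (c : R) : 0 < c ->
  uniformly_tends c pi sawtooth (fun=> pi / 2).
Proof.
move=> c0 e e0; have [cpi|pic] := ltP c pi; last first.
  exists 0%N => M _ x /andP[cx xpi].
  have -> : x = pi by apply/le_anti; rewrite xpi (le_trans pic).
  by rewrite sawtooth_pi subrr normr0 ltW.
have pi0 := pi_gt0 R.
set s := sin (c / 2).
have s0 : 0 < s by apply: sin_gt0_pihalf; lra.
have sx x : c <= x <= pi -> s <= sin (x / 2).
  move=> h; apply: (nondecreasing_derive (f' := cos)) => [|t tI]; first by lra.
  by apply: cos_ge0_pihalf; lra.
(* Two boundary terms of size 1/(2s), and a derivative of size 1/(4 s^2) over a length of at most
   [pi]; all are divided by [l] below. *)
pose K := s^-1 + pi / (4 * s ^+ 2).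
have K0 : 0 < K by rewrite addr_gt0 ?invr_gt0// divr_gt0// mulr_gt0// exprn_gt0.
exists (Num.bound (K / e)) => M MK x /andP[cx xpi].
set l := M%:R + 2^-1 : R.
have Kl : K / l <= e.
  have l0 : 0 < l by rewrite /l; have := ler0n R M; lra.
  rewrite ler_pdivrMr// mulrC -ler_pdivrMr//.
  have := archi_boundP (ltW (divr_gt0 K0 e0)).
  have : (Num.bound (K / e))%:R <= M%:R :> R by rewrite ler_nat.
  by rewrite /l; lra.
apply: le_trans Kl.
have l0 : 0 < l by rewrite /l; have := ler0n R M; lra.
(* Integration by parts without integrals: the term added to [sawtooth] in [U] cancels the kernel
   sin(l t) / (2 sin(t/2)) in the derivative and leaves only the part with [g1], which carries the
   factor 1/l. *)
pose g t := (2 * sin (t / 2))^-1 : R.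
pose U t := sawtooth M t + g t * (cos (l * t) / l).
pose g1 t := - cos (t / 2) / (2 * sin (t / 2)) ^+ 2 : R.
have dU t : x <= t <= pi -> is_derive t 1 U (g1 t * (cos (l * t) / l)).
  move=> tI; have st : s <= sin (t / 2) by apply: sx; lra.
  have s2 : 2 * sin (t / 2) != 0 by rewrite gt_eqF//; lra.
  have st0 : sin (t / 2) != 0 by rewrite gt_eqF//; lra.
  rewrite /U /g; derive_eq.
    notypeclasses refine (derive_add_fun (is_derive_sawtooth M t) _).
    by notypeclasses refine (derive_mul_fun 
      (derive_inv_fun (f := fun t => 2 * sin (t / 2)) s2 _) _);
      repeat derive_step.
  have -> : dirichlet M t = sin (l * t) / (2 * sin (t / 2)).
    by rewrite -dirichletE mulrAC divff// mul1r.
  rewrite /g1 /=; field.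
  by rewrite st0 gt_eqF.
have gb t : c <= t <= pi -> `|g t * (cos (l * t) / l)| <= (2 * s)^-1 / l.
  move=> tI; have st := sx t tI.
  rewrite mulrA normrM [X in _ * X]gtr0_norm ?invr_gt0// ler_pM2r ?invr_gt0//.
  rewrite normrM [X in X * _]gtr0_norm; last by rewrite invr_gt0; lra.
  rewrite -[leRHS]mulr1 ler_pM//.
  - by rewrite invr_ge0; lra.
  - by rewrite lef_pV2 ?posrE; lra.
  - by rewrite ler_norml cos_geN1 cos_le1.
have g1b t : x <= t <= pi -> `|g1 t * (cos (l * t) / l)| <= (4 * s ^+ 2)^-1 / l.
  move=> tI; have st : s <= sin (t / 2) by apply: sx; lra.
  rewrite mulrA normrM [X in _ * X]gtr0_norm ?invr_gt0// ler_pM2r ?invr_gt0//.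
  rewrite normrM -[leRHS]mulr1 ler_pM//; last first.
    by rewrite ler_norml cos_geN1 cos_le1.
  rewrite /g1 normrM normrN -[leRHS]mul1r ler_pM//.
    by rewrite ler_norml cos_geN1 cos_le1.
  rewrite gtr0_norm; last by rewrite invr_gt0 exprn_gt0//; lra.
  rewrite lef_pV2 ?posrE; [|by rewrite exprn_gt0//; lra|by rewrite mulr_gt0// exprn_gt0].
  have -> : 4 * s ^+ 2 = (2 * s) ^+ 2 by ring.
  by rewrite ler_pXn2r ?nnegrE//; lra.
have := mean_value_bound xpi dU g1b.
rewrite /U sawtooth_pi => h.
have h1 : `|g pi * (cos (l * pi) / l)| <= (2 * s)^-1 / l by apply: gb; lra.
have h2 : `|g x * (cos (l * x) / l)| <= (2 * s)^-1 / l by apply: gb; lra.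
have h3 : (4 * s ^+ 2)^-1 / l * (pi - x) <= (4 * s ^+ 2)^-1 / l * pi.
  apply: ler_wpM2l; last by lra.
  by rewrite divr_ge0 ?(ltW l0)// invr_ge0 mulr_ge0// sqr_ge0.
have -> : K / l = (2 * s)^-1 / l + (2 * s)^-1 / l + (4 * s ^+ 2)^-1 / l * pi.
  by rewrite /K; field; rewrite !gt_eqF.
move: h h1 h2; set A := g pi * _; set B := g x * _.
by rewrite !ler_norml; lra.
Qed.

End Sawtooth.

(** * The inner sums *)

Section Hyperbolic.
Variable R : realType.
Implicit Types x y : R.

Definition sinh x := (expR x - expR (- x)) / 2.
Definition cosh x := (expR x + expR (- x)) / 2.

Lemma sinh0 : sinh 0 = 0. Proof. by rewrite /sinh oppr0 subrr mul0r. Qed.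

Lemma sinh_gt0 x : 0 < x -> 0 < sinh x.
Proof.
by move=> x0; have : expR (- x) < expR x; [rewrite ltr_expR; lra|rewrite /sinh; lra].
Qed.

Lemma sinh_ge0 x : 0 <= x -> 0 <= sinh x.
Proof.
by rewrite le_eqVlt => /predU1P[<-|/sinh_gt0/ltW//]; rewrite sinh0.
Qed.

Lemma cosh_gt0 x : 0 < cosh x.
Proof. by have := expR_gt0 x; have := expR_gt0 (- x); rewrite /cosh; lra. Qed.

Lemma coshDsinh x : cosh x + sinh x = expR x.
Proof. by rewrite /cosh /sinh; lra. Qed.

Lemma sinhD x y : sinh (x + y) = sinh x * cosh y + cosh x * sinh y.
Proof. by rewrite /sinh /cosh opprD !expRD; field. Qed.

Lemma derive_sinh_fun (f : R -> R) x a : is_derive x 1 f a ->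
  is_derive x 1 (fun t => sinh (f t)) (a * cosh (f x)).
Proof.
move=> df; rewrite /sinh; derive_eq.
  notypeclasses refine (derive_mul_fun (derive_add_fun (derive_expR_fun df)
    (derive_opp_fun (derive_expR_fun (derive_opp_fun df)))) (derive_cst_fun _ _)).
by rewrite /cosh /=; field.
Qed.

Lemma derive_cosh_fun (f : R -> R) x a : is_derive x 1 f a ->
  is_derive x 1 (fun t => cosh (f t)) (a * sinh (f x)).
Proof.
move=> df; rewrite /cosh; derive_eq.
  notypeclasses refine (derive_mul_fun (derive_add_fun (derive_expR_fun df)
    (derive_expR_fun (derive_opp_fun df))) (derive_cst_fun _ _)).
by rewrite /sinh /=; field.
Qed.

End Hyperbolic.

Ltac derive_hyp_step := first
  [ notypeclasses refine (derive_sinh_fun _)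
  | notypeclasses refine (derive_cosh_fun _)
  | derive_step ].
Ltac derive_hyp_tac := derive_eq; [repeat derive_hyp_step|rewrite /=].

Section SineSeries.
Variable R : realType.

Lemma sin_le (x : R) : 0 <= x -> `|sin x| <= x.
Proof.
move=> x0; have := @mean_value_bound R sin cos 0 x 1 x0.
rewrite sin0 !subr0 mul1r; apply=> // t _.
by rewrite ler_norml cos_geN1 cos_le1.
Qed.

Lemma sum_inv_sqr_le M : \sum_(1 <= m < M.+1) (m%:R ^+ 2)^-1 <= 2 :> R.
Proof.
case: M => [|M]; first by rewrite big_geq.
(* The sharper bound makes the induction work, by comparison with the telescoping series of 1/(m (m
   + 1)). *)
suff : \sum_(1 <= m < M.+2) (m%:R ^+ 2)^-1 <= 2 - (M.+1%:R)^-1 :> R.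
  by move=> h; apply: le_trans h _; rewrite gerBl invr_ge0.
elim: M => [|M IH]; first by rewrite big_nat1 expr1n invr1; lra.
rewrite big_nat_recr//=; apply: le_trans (lerD IH (lexx _)) _.
rewrite -[M.+2%:R]natr1; set n := M.+1%:R; have n0 : 0 < n :> R by [].
rewrite -subr_ge0 (_ : _ - _ = (n * (n + 1) ^+ 2)^-1).
  by rewrite invr_ge0 mulr_ge0 ?sqr_ge0// ltW.
by field; rewrite !gt_eqF// addr_gt0.
Qed.

(** Termwise |sin(m x)| <= m x. This gives the linear bound near 0 that [bvp_uniformly_tends] asks
    for. *)
Lemma sin_series_le (c : nat -> R) M (x : R) : 0 <= x ->
  (forall m, (0 < m)%N -> 0 <= c m <= (m%:R ^+ 3)^-1) ->
  `|\sum_(1 <= m < M.+1) sin (m%:R * x) * c m| <= 2 * x.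
Proof.
move=> x0 hc; apply: le_trans (ler_norm_sum _ _ _) _.
apply: le_trans (_ : \sum_(1 <= m < M.+1) (m%:R ^+ 2)^-1 * x <= _); last first.
  by rewrite -mulr_suml ler_wpM2r// sum_inv_sqr_le.
apply: ler_sum_nat => m /andP[m0 _]; have /andP[c0 cm] := hc m m0.
have mR : 0 < m%:R :> R by rewrite ltr0n.
rewrite normrM (ger0_norm c0).
have -> : (m%:R ^+ 2)^-1 * x = (m%:R * x) * (m%:R ^+ 3)^-1.
  by field; rewrite gt_eqF.
by rewrite ler_pM// sin_le// mulr_ge0// ltW.
Qed.

End SineSeries.

(** * Closed forms of the inner sums as solutions of boundary value problems *)

Section Resolvent.
Variables (R : realType) (a : R).
Hypothesis a0 : 0 < a.

Local Notation s := (sinh (a * pi)).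

(* The linear term makes [resolvent_sum'' = a^2 resolvent_sum - sawtooth] hold
   exactly, since [x / 2] is the linear term of [sawtooth]. *)
Definition resolvent_sum (M : nat) (x : R) : R :=
  x / (2 * a ^+ 2) +
  \sum_(1 <= m < M.+1) sin (m%:R * x) * (m%:R * (m%:R ^+ 2 + a ^+ 2))^-1.

(** The solution of v'' = a^2 v - pi/2 with v(0) = 0 and v(pi) = pi / (2 a^2). The inner bracket
    equals sinh(a (pi - x)) / sinh(a pi). *)
Definition resolvent_lim (x : R) : R :=
  pi / (2 * a ^+ 2) *
  (1 - (expR (- (a * x)) - expR (- (a * pi)) * sinh (a * x) / s)).

Definition square_resolvent_sum (M : nat) (x : R) : R :=
  \sum_(1 <= m < M.+1) sin (m%:R * x) * (m%:R / (m%:R ^+ 2 + a ^+ 2) ^+ 2).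

(** Up to the factor pi / (4 a), the solution of v'' = a^2 v - (pi/2 - a^2 [resolvent_lim]) that
    vanishes at 0 and [pi]. *)
Definition psi (x : R) : R :=
  x * expR (- (a * x)) +
  (x * (expR (- (a * pi)) * s) * cosh (a * x) - pi * sinh (a * x)) / s ^+ 2.

Let s0 : 0 < s. Proof. by rewrite sinh_gt0// mulr_gt0// pi_gt0. Qed.

Let den_gt0 m : (0 < m)%N -> 0 < m%:R ^+ 2 + a ^+ 2.
Proof. by move=> m0; rewrite addr_gt0// exprn_gt0// ltr0n. Qed.

Let m_neq0 m : (0 < m)%N -> m%:R != 0 :> R.
Proof. by rewrite pnatr_eq0 -lt0n. Qed.

Lemma resolvent_uniformly_tends :
  uniformly_tends 0 pi resolvent_sum resolvent_lim.
Proof.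
have pi0 := pi_gt0 R.
apply: (@bvp_uniformly_tends R a pi ((2 * a ^+ 2)^-1 + 2) resolvent_sum
  (fun M x => (2 * a ^+ 2)^-1 +
    \sum_(1 <= m < M.+1) cos (m%:R * x) / (m%:R ^+ 2 + a ^+ 2))
  (fun M x => - sawtooth M x) resolvent_lim
  (fun x => pi / (2 * a ^+ 2) * (a * expR (- (a * x)) +
    expR (- (a * pi)) * a * cosh (a * x) / s))
  (fun=> - (pi / 2))) => //.
- by rewrite addr_ge0// invr_ge0 mulr_ge0// sqr_ge0.
- move=> M x; apply: derive_add_fun; first by derive_tac; ring.
  apply: (@derive_sum_fun R x M
    (fun m t => sin (m%:R * t) * (m%:R * (m%:R ^+ 2 + a ^+ 2))^-1)
    (fun m => cos (m%:R * x) / (m%:R ^+ 2 + a ^+ 2))) => m m0; derive_tac.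
  by field; rewrite m_neq0// gt_eqF// den_gt0.
- move=> M x; derive_eq.
    notypeclasses refine (derive_add_fun (derive_cst_fun _ _) _).
    apply: (@derive_sum_fun R x M
      (fun m t => cos (m%:R * t) / (m%:R ^+ 2 + a ^+ 2))
      (fun m => - m%:R * sin (m%:R * x) / (m%:R ^+ 2 + a ^+ 2))) => m m0; derive_tac.
    by field; rewrite gt_eqF// den_gt0.
  rewrite /resolvent_sum /sawtooth opprD mulrDr addrACA mulr_sumr -sumrB.
  congr (_ + _); first by field; rewrite gt_eqF.
  apply: eq_big_nat => m /andP[m0 _].
  by field; rewrite m_neq0// gt_eqF// den_gt0.
- move=> x; rewrite /resolvent_lim; derive_hyp_tac.
  by field; rewrite !gt_eqF.
- move=> x; rewrite /resolvent_lim; derive_hyp_tac.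
  by field; rewrite !gt_eqF.
- move=> M x /andP[x0 _]; rewrite /resolvent_sum [leRHS]mulrDl.
  apply: le_trans (ler_normD _ _) _; apply: lerD.
    by rewrite ger0_norm; [rewrite mulrC|rewrite divr_ge0// mulr_ge0// sqr_ge0].
  apply: sin_series_le => // m m0; have mR : 0 < m%:R :> R by rewrite ltr0n.
  have md : 0 < m%:R * (m%:R ^+ 2 + a ^+ 2) by rewrite mulr_gt0// den_gt0.
  rewrite invr_ge0 (ltW md)/= lef_pV2 ?posrE ?exprn_gt0//.
  by rewrite (exprS _ 2) ler_pM2l// lerDl sqr_ge0.
- by rewrite /resolvent_lim mulr0 oppr0 expR0 sinh0; ring.
- move=> M; rewrite /resolvent_sum big1 => [|m _]; last by rewrite sin_natmul_pi mul0r.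
  by rewrite /resolvent_lim; field; rewrite !gt_eqF.
move=> c c0 e e0; have [M0 hM0] := sawtooth_uniformly_tends c0 e0.
by exists M0 => M MM x xI; rewrite opprK addrC distrC; apply: hM0.
Qed.

(** The right-hand side of the equation is a combination of [sawtooth] and [resolvent_sum], so the
    two previous limits feed a second boundary value problem. *)
Lemma square_resolvent_uniformly_tends :
  uniformly_tends 0 pi square_resolvent_sum (fun x => pi / (4 * a) * psi x).
Proof.
have pi0 := pi_gt0 R.
apply: (@bvp_uniformly_tends R a pi 2 square_resolvent_sum
  (fun M x => \sum_(1 <= m < M.+1) cos (m%:R * x) *
    (m%:R ^+ 2 / (m%:R ^+ 2 + a ^+ 2) ^+ 2))
  (fun M x => - (sawtooth M x - a ^+ 2 * resolvent_sum M x)) _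
  (fun x => pi / (4 * a) * (expR (- (a * x)) - a * x * expR (- (a * x)) +
    (expR (- (a * pi)) * s * cosh (a * x) + x * (expR (- (a * pi)) * s) * a * sinh (a * x)
       - pi * a * cosh (a * x)) / s ^+ 2))
  (fun x => - (pi / 2 - a ^+ 2 * resolvent_lim x))) => //.
- move=> M x.
  apply: (@derive_sum_fun R x M
    (fun m t => sin (m%:R * t) * (m%:R / (m%:R ^+ 2 + a ^+ 2) ^+ 2))
    (fun m => cos (m%:R * x) * (m%:R ^+ 2 / (m%:R ^+ 2 + a ^+ 2) ^+ 2))) => m m0; derive_tac.
  by field; rewrite gt_eqF// den_gt0.
- move=> M x; derive_eq.
    apply: (@derive_sum_fun R x M
      (fun m t => cos (m%:R * t) * (m%:R ^+ 2 / (m%:R ^+ 2 + a ^+ 2) ^+ 2))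
      (fun m => - sin (m%:R * x) * (m%:R ^+ 3 / (m%:R ^+ 2 + a ^+ 2) ^+ 2))) => m m0; derive_tac.
    by field; rewrite gt_eqF// den_gt0.
  rewrite /resolvent_sum /sawtooth /square_resolvent_sum.
  set A := \sum_(_ <= _ < _) _; set B := \sum_(_ <= _ < _) _.
  set B' := \sum_(_ <= _ < _) _; set C := \sum_(_ <= _ < _) _.
  (* Termwise, with D = m^2 + a^2: -m^3 / D^2 = a^2 m / D^2 - 1/m + a^2 / (m D). The linear terms of
     [sawtooth] and [resolvent_sum] then cancel. *)
  have -> : A = a ^+ 2 * B - B' + a ^+ 2 * C.
    rewrite !mulr_sumr -sumrB -big_split; apply: eq_big_nat => m /andP[m0 _] /=.
    by field; rewrite m_neq0// gt_eqF// den_gt0.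
  by field; rewrite gt_eqF.
- move=> x; rewrite /psi; derive_hyp_tac.
  by field; rewrite !gt_eqF.
- move=> x; rewrite /psi; derive_hyp_tac.
  by rewrite /resolvent_lim; field; rewrite !gt_eqF.
- move=> M x /andP[x0 _]; apply: sin_series_le => // m m0.
  have mR : 0 < m%:R :> R by rewrite ltr0n.
  have Dm : 0 < (m%:R ^+ 2 + a ^+ 2) ^+ 2 by rewrite exprn_gt0// den_gt0.
  rewrite (divr_ge0 (ltW mR) (ltW Dm))/=.
  have -> : (m%:R ^+ 3)^-1 = m%:R / (m%:R ^+ 2) ^+ 2 :> R by field; rewrite gt_eqF.
  rewrite ler_pM2l// lef_pV2 ?posrE ?exprn_gt0 ?den_gt0//.
  by rewrite ler_pXn2r ?nnegrE ?lerDl ?sqr_ge0// ltW// den_gt0.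
- by rewrite /psi /= mulr0 oppr0 expR0 sinh0; ring.
- move=> M; rewrite /square_resolvent_sum big1 => [|m _]; last by rewrite sin_natmul_pi mul0r.
  rewrite /psi /=.
  (* That [psi] vanishes at [pi] amounts to cosh^2 - sinh^2 = 1. *)
  have E : expR (- (a * pi)) = cosh (a * pi) - s by rewrite /cosh /sinh; lra.
  have E2 : cosh (a * pi) ^+ 2 = s ^+ 2 + 1.
    by rewrite /cosh /sinh expRN; field; rewrite gt_eqF ?expR_gt0.
  rewrite E; apply/esym.
  have -> : pi / (4 * a) * (pi * (cosh (a * pi) - s) +
      (pi * ((cosh (a * pi) - s) * s) * cosh (a * pi) - pi * s) / s ^+ 2) =
    pi / (4 * a) * (pi * (cosh (a * pi) ^+ 2 - s ^+ 2 - 1)) / s.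
    by field; rewrite !gt_eqF.
  by rewrite E2; ring.
move=> c c0 e e0.
have [M1 hM1] := sawtooth_uniformly_tends c0 (divr_gt0 e0 (ltr0n R 2)).
have e1 : 0 < e / 2 / a ^+ 2 by rewrite !divr_gt0// exprn_gt0.
have [M2 hM2] := resolvent_uniformly_tends e1.
exists (maxn M1 M2) => M; rewrite geq_max => /andP[MM1 MM2] x xI.
have h1 := hM1 M MM1 x xI.
have h2 : `|resolvent_sum M x - resolvent_lim x| <= e / 2 / a ^+ 2.
  by apply: hM2 => //; lra.
rewrite (_ : _ - _ = - (sawtooth M x - pi / 2)
    + a ^+ 2 * (resolvent_sum M x - resolvent_lim x)); last by ring.
apply: le_trans (ler_normD _ _) _; rewrite normrN normrM ger0_norm ?sqr_ge0//.
have : a ^+ 2 * `|resolvent_sum M x - resolvent_lim x| <= e / 2.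
  by rewrite mulrC -ler_pdivlMr// exprn_gt0.
lra.
Qed.

End Resolvent.

(** * Bounds for the sum over n *)

Section NumericalBounds.
Variable R : realType.

Lemma expR_ge_quadratic (x : R) : 0 <= x -> 1 + x + x ^+ 2 / 2 <= expR x.
Proof.
move=> x0; rewrite -subr_ge0.
have h := @nondecreasing_derive R (fun t => expR t - (1 + t + t ^+ 2 / 2))
  (fun t => expR t - (1 + t)) 0 x x0.
have : expR (0 : R) - (1 + 0 + 0 ^+ 2 / 2) <= expR x - (1 + x + x ^+ 2 / 2).
  apply: h => t /andP[t0 _]; last by rewrite subr_ge0 expR_ge1Dx.
  by rewrite (_ : (fun _ => _) = fun t : R => expR t - (1 + t + t * t / 2));
    [derive_tac; field|apply/funext => u; rewrite expr2].
by rewrite expR0; lra.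
Qed.

(** Otherwise w = pi/4 is below 7/10, so sin(w)^2 <= w^2 < 49/100, whereas cos(2 w) = 0 forces
    sin(w)^2 = 1/2. *)
Lemma pi_ge14_5 : 14 / 5 <= pi :> R.
Proof.
rewrite leNgt; apply/negP => h; have pi0 := pi_gt0 R.
pose w := pi / 2 / 2 : R.
have : cos (w + w) = 0 by rewrite -splitr cos_pihalf.
rewrite cosD; have : `|sin w| <= w by apply: sin_le; rewrite /w; lra.
have := cos2Dsin2 w; have : w < 7 / 10 by rewrite /w; lra.
set u := sin w; set v := cos w; rewrite ler_norml.
by move=> w7 uv1 /andP[u1 u2] uv0; nra.
Qed.

(** The quadratic bound at 7/40 gives at least 1.19, whose fourth power exceeds 2; the sixteenth
    power then gives 2^4. *)
Lemma expR14_5_ge16 : 16 <= expR (14 / 5) :> R.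
Proof.
have -> : 14 / 5 = 16%:R * (7 / 40) :> R by field.
rewrite expRM_natl.
have h : 119 / 100 <= expR (7 / 40 : R).
  by apply: le_trans (expR_ge_quadratic _); lra.
have h4 : 2 <= expR (7 / 40 : R) ^+ 4.
  apply: le_trans (_ : (119 / 100) ^+ 4 <= _); first by lra.
  by apply: lerXn2r => //; rewrite nnegrE; lra.
have -> : expR (7 / 40 : R) ^+ 16 = (expR (7 / 40) ^+ 4) ^+ 4 by rewrite -exprM.
apply: le_trans (_ : 2 ^+ 4 <= _); first by lra.
by apply: lerXn2r => //; rewrite nnegrE; lra.
Qed.

Lemma expR_pi_ge : 16 * (1 + (pi - 14 / 5)) <= expR pi :> R.
Proof.
rewrite [leRHS](_ : _ = expR (14 / 5) * expR (pi - 14 / 5)); last first.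
  by rewrite -expRD; congr expR; ring.
have := pi_ge14_5 => h; apply: ler_pM; [by []|lra|exact: expR14_5_ge16|].
exact: expR_ge1Dx.
Qed.

Lemma expR_pi_ge16 : 16 <= expR pi :> R.
Proof. by have := expR_pi_ge; have := pi_ge14_5; lra. Qed.

(** The constant is the one that [psi_rest_sum_bounds] needs: pi / sinh(pi) <= 7/16. *)
Lemma sinh_pi_ge : 16 / 7 * pi <= sinh (pi : R).
Proof.
rewrite /sinh expRN.
have h1 := expR_pi_ge16; have h2 := pi_ge14_5; have h3 := expR_pi_ge.
have : (expR pi)^-1 <= 1 :> R by rewrite invf_le1; lra.
lra.
Qed.

Lemma cosh_ge1 (x : R) : 1 <= cosh x.
Proof. by have := expR_ge1Dx x; have := expR_ge1Dx (- x); rewrite /cosh; lra. Qed.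

Lemma sinh_ge (x : R) : 0 <= x -> x <= sinh x.
Proof.
move=> x0; rewrite -subr_ge0.
have : sinh 0 - 0 <= sinh x - x.
  apply: (@nondecreasing_derive R (fun t => sinh t - t) (fun t => cosh t - 1)) => // t _.
    by derive_hyp_tac; ring.
  by rewrite subr_ge0 cosh_ge1.
by rewrite sinh0; lra.
Qed.

Lemma sinh_nondecreasing (x y : R) : x <= y -> sinh x <= sinh y.
Proof.
move=> xy; have h1 : expR x <= expR y by rewrite ler_expR.
have h2 : expR (- y) <= expR (- x) by rewrite ler_expR lerN2.
by rewrite /sinh; lra.
Qed.

Lemma cosh_nondecreasing (x y : R) : 0 <= x -> x <= y -> cosh x <= cosh y.
Proof.
move=> x0 xy; apply: (nondecreasing_derive (f' := @sinh R)) => // t.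
  by move=> _; rewrite -[sinh t]mul1r; apply: derive_cosh_fun; exact: derive_id_fun.
by case/andP => xt _; rewrite sinh_ge0// (le_trans x0).
Qed.

Lemma cosh_ge_quadratic (x : R) : 0 <= x -> 1 + x ^+ 2 / 2 <= cosh x.
Proof.
move=> x0.
have -> : cosh x = 1 + 2 * sinh (x / 2) ^+ 2.
  rewrite /cosh /sinh {1 2}(_ : x = x / 2 + x / 2); last by field.
  by rewrite opprD !expRD expRN; field; rewrite gt_eqF ?expR_gt0.
have : x / 2 <= sinh (x / 2) by apply: sinh_ge; lra.
by move: (sinh _) => u hu; nra.
Qed.

Lemma mul_cosh_le (t : R) : 0 <= t -> t * cosh t <= (1 + t) * sinh t.
Proof.
move=> t0; rewrite -subr_ge0.
have -> : (1 + t) * sinh t - t * cosh t = sinh t - t * expR (- t).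
  by rewrite /sinh /cosh; field.
have h : expR (- t) <= 1 by rewrite -expR0 ler_expR; lra.
have := sinh_ge t0; have := expR_gt0 (- t); nra.
Qed.

(** The quotient sinh(n x) / sinh(x) is nondecreasing in [x]; clearing denominators admits [x = 0].
    The induction uses the addition formula and the monotonicity of [cosh]. *)
Lemma sinh_natmul_le n (x p : R) : 0 <= x -> x <= p ->
  sinh (n%:R * x) * sinh p <= sinh x * sinh (n%:R * p).
Proof.
move=> x0 xp; have p0 := le_trans x0 xp.
elim: n => [|n IH]; first by rewrite !mul0r sinh0 mul0r mulr0.
rewrite -!natr1 !mulrDl !mul1r !sinhD.
have h1 : cosh x <= cosh p by apply: cosh_nondecreasing.
have h2 : cosh (n%:R * x) <= cosh (n%:R * p).
  by apply: cosh_nondecreasing; rewrite ?mulr_ge0// ler_wpM2l.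
have s0 : 0 <= sinh (n%:R * p) by rewrite sinh_ge0// mulr_ge0.
have sx : 0 <= sinh x by exact: sinh_ge0.
have sp : 0 <= sinh p by rewrite sinh_ge0.
have k0 : 0 <= cosh x by rewrite ltW// cosh_gt0.
have k1 : 0 <= cosh (n%:R * x) by rewrite ltW// cosh_gt0.
rewrite [leLHS](_ : _ = sinh (n%:R * x) * sinh p * cosh x
  + cosh (n%:R * x) * (sinh x * sinh p)); last by ring.
rewrite [leRHS](_ : _ = sinh x * sinh (n%:R * p) * cosh p
  + cosh (n%:R * p) * (sinh x * sinh p)); last by ring.
apply: lerD; last by rewrite ler_wpM2r// mulr_ge0.
by rewrite ler_pM// mulr_ge0// sinh_ge0// mulr_ge0.
Qed.

Lemma sinh_natmul_ge n : expR pi ^+ n * sinh pi <= sinh (n.+1%:R * pi) :> R.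
Proof.
have pi0 := pi_gt0 R.
have -> : n.+1%:R * pi = pi + n%:R * pi :> R by rewrite -natr1; ring.
rewrite sinhD -expRM_natl -(coshDsinh (n%:R * pi)).
have : sinh pi <= cosh (pi : R).
  by have := expR_gt0 (- pi : R); rewrite /sinh /cosh; lra.
have : 0 <= sinh (n%:R * pi : R) by rewrite sinh_ge0// mulr_ge0// ltW.
nra.
Qed.

(** Keeping the factor sin(y) lets the first term of a sine sum dominate the others even where
    sin(y) is small. *)
Lemma norm_sin_natmul_le n (y : R) : 0 <= y <= pi ->
  `|sin (n%:R * y)| <= n%:R * sin y.
Proof.
move=> ypi; have sy := sin_ge0_pi ypi.
elim: n => [|n IH]; first by rewrite !mul0r sin0 normr0.
rewrite -natr1 !mulrDl !mul1r sinD; apply: le_trans (ler_normD _ _) _.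
apply: lerD; rewrite normrM.
  by rewrite (le_trans _ IH)// ler_piMr// ler_norml cos_geN1 cos_le1.
by rewrite (ger0_norm sy) ler_piMl// ler_norml cos_geN1 cos_le1.
Qed.

(** Since n <= 2^(n-1), each term is at most 8^-(n-1), and these sum to 1/7 from n = 2 on. *)
Lemma geometric_sum_le N (r : R) : 0 <= r -> r <= 16^-1 ->
  \sum_(2 <= n < N.+1) n%:R * r ^+ n.-1 <= 7^-1.
Proof.
move=> r0 r16; case: N => [|N]; first by rewrite big_geq.
suff : \sum_(2 <= n < N.+2) n%:R * r ^+ n.-1 <= (1 - 8^-1 ^+ N) / 7.
  by have : 0 <= (8^-1 : R) ^+ N by []; lra.
elim: N => [|N IH]; first by rewrite big_geq// expr0 subrr mul0r.
rewrite big_nat_recr//=.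
have h : N.+2%:R * r ^+ N.+1 <= 8^-1 ^+ N.+1 :> R.
  apply: le_trans (_ : 2 ^+ N.+1 * r ^+ N.+1 <= _).
    rewrite ler_wpM2r ?exprn_ge0// -natrX ler_nat; exact: ltn_expl.
  rewrite -exprMn lerXn2r ?nnegrE//; lra.
apply: le_trans (lerD IH h) _.
rewrite exprS; lra.
Qed.

End NumericalBounds.

(** * Main part and remainder of the sum over n *)

Section PsiSum.
Variable R : realType.

Definition psi_rest (n : nat) (x : R) : R :=
  let s := sinh (n%:R * pi) in
  (x * (expR (- (n%:R * pi)) * s) * cosh (n%:R * x) - pi * sinh (n%:R * x)) / s ^+ 2.

Lemma psiE n (x : R) : psi n%:R x = x * expR (- x) ^+ n + psi_rest n x.
Proof. by rewrite /psi -expRM_natl mulrN. Qed.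

(** The positive part of the numerator is k x cosh(n x), where k = e^(-n pi) sinh(n pi) <= 1/2 and x
    cosh(n x) <= (1 + pi) sinh(n x). It is thus at most (1 + pi)/2 sinh(n x), hence at most 3 pi/4
    sinh(n x) because pi >= 2. *)
Lemma psi_rest_bounds n (x : R) : (0 < n)%N -> 0 <= x -> x <= pi ->
  - (pi * (sinh (n%:R * x) / sinh (n%:R * pi) ^+ 2)) <= psi_rest n x
  <= - (pi / 4 * (sinh (n%:R * x) / sinh (n%:R * pi) ^+ 2)).
Proof.
move=> n0 x0 xpi; rewrite /psi_rest.
have n1 : 1 <= n%:R :> R by rewrite ler1n.
have pi2 := pi_ge2 R.
have s0 : 0 < sinh (n%:R * pi : R) by rewrite sinh_gt0// mulr_gt0//; lra.
have k0 : 0 < expR (- (n%:R * pi)) * sinh (n%:R * pi) :> R by rewrite mulr_gt0// expR_gt0.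
have k1 : expR (- (n%:R * pi)) * sinh (n%:R * pi) <= 2^-1 :> R.
  rewrite /sinh mulrA mulrBr -!expRD addNr expR0.
  by have := expR_gt0 (- (n%:R * pi) + - (n%:R * pi) : R); lra.
have c0 := cosh_gt0 (n%:R * x).
have hc : x * cosh (n%:R * x) <= (1 + pi) * sinh (n%:R * x).
  have nx0 : 0 <= n%:R * x by rewrite mulr_ge0.
  have := mul_cosh_le nx0; have := sinh_ge0 nx0.
  move: (sinh _) (cosh _) => S C S0 h.
  have h2 : n%:R * (x * C) <= n%:R * ((1 + pi) * S).
    rewrite mulrA (le_trans h)// mulrA ler_wpM2r// mulrDr mulr1.
    by rewrite lerD// ler_wpM2l.
  by move: h2; rewrite ler_pM2l//; lra.
have S0 : 0 <= sinh (n%:R * x) by rewrite sinh_ge0// mulr_ge0.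
move: (expR _ * _) k0 k1 hc c0 S0 => k k0 k1.
move: (sinh (n%:R * x)) (cosh _) => S C hc C0 S0.
have xC : 0 <= x * C by rewrite mulr_ge0// ltW.
have kxC0 : 0 <= k * (x * C) by rewrite mulr_ge0// ltW.
have kxC : k * (x * C) <= 2^-1 * ((1 + pi) * S) by rewrite ler_pM// ltW.
have i0 : 0 < (sinh (n%:R * pi : R) ^+ 2)^-1 by rewrite invr_gt0 exprn_gt0.
rewrite [X in X <= _ <= _](_ : _ = (- (pi * S)) / sinh (n%:R * pi) ^+ 2); last by ring.
rewrite [X in _ <= X <= _](_ : _ =
  (k * (x * C) - pi * S) / sinh (n%:R * pi) ^+ 2); last by ring.
rewrite [X in _ <= _ <= X](_ : _ =
  (- (pi / 4 * S)) / sinh (n%:R * pi) ^+ 2); last by ring.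
rewrite !ler_pM2r//; apply/andP; split; nra.
Qed.

(** Put Q = pi q sin(y). The first term lies in [-Q, -Q/4] and the others add up to at most Q/7 in
    absolute value. As 1/7 < 1/4 the sum is nonpositive, and as Q <= 7/16 it is at least
    -(8/7)(7/16) = -1/2. *)
Lemma psi_rest_sum_bounds N (x y : R) : 0 <= x -> x <= pi -> 0 <= y <= pi ->
  - 2^-1 <= \sum_(1 <= n < N.+1) sin (n%:R * y) * psi_rest n x <= 0.
Proof.
move=> x0 xpi ypi; case: N => [|N]; first by rewrite big_geq// lexx; lra.
have pi2 := pi_ge2 R.
rewrite big_ltn//= mul1r.
have sy := sin_ge0_pi ypi.
pose s := sinh (pi : R); have s0 : 0 < s by rewrite sinh_gt0// pi_gt0.
pose q := sinh x / s ^+ 2.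
have q0 : 0 <= q by rewrite divr_ge0 ?sinh_ge0// exprn_ge0// ltW.
have qs : q <= s^-1.
  rewrite /q expr2 invfM mulrA ler_piMl ?invr_ge0 ?(ltW s0)//.
  by rewrite ler_pdivrMr// mul1r sinh_nondecreasing.
pose r := (expR pi)^-1 : R.
have r0 : 0 < r by rewrite invr_gt0 expR_gt0.
have r16 : r <= 16^-1 by rewrite lef_pV2 ?posrE ?expR_gt0// expR_pi_ge16.
have qn n : (0 < n)%N -> sinh (n%:R * x) / sinh (n%:R * pi) ^+ 2 <= r ^+ n.-1 * q.
  case: n => // n _ /=.
  have sn0 : 0 < sinh (n.+1%:R * pi : R) by rewrite sinh_gt0// mulr_gt0//; lra.
  have h1 := @sinh_natmul_le R n.+1 x pi x0 xpi; have h2 := @sinh_natmul_ge R n.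
  apply: le_trans (_ : sinh x / s / sinh (n.+1%:R * pi) <= _).
    rewrite ler_pdivrMr ?exprn_gt0// expr2 mulrA divfK ?gt_eqF//.
    by rewrite mulrAC ler_pdivlMr.
  rewrite [leRHS](_ : _ = sinh x / s * (r ^+ n / s)); last first.
    by rewrite /q; field; rewrite gt_eqF.
  apply: ler_wpM2l; first by rewrite divr_ge0 ?(ltW s0)// sinh_ge0.
  rewrite /r exprVn -invfM lef_pV2 ?posrE//.
  by rewrite mulr_gt0// exprn_gt0// expR_gt0.
have yq0 : 0 <= sin y * pi * q := mulr_ge0 (mulr_ge0 sy (pi_ge0 R)) q0.
have tail : `|\sum_(2 <= n < N.+2) sin (n%:R * y) * psi_rest n x| <= 7^-1 * (sin y * pi * q).
  apply: le_trans (ler_norm_sum _ _ _) _.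
  apply: le_trans (_ : \sum_(2 <= n < N.+2) n%:R * r ^+ n.-1 * (sin y * pi * q) <= _); last first.
    by rewrite -mulr_suml; apply: ler_wpM2r => //; rewrite geometric_sum_le// ltW.
  apply: ler_sum_nat => n /andP[n2 _]; have n0 : (0 < n)%N by exact: leq_trans n2.
  rewrite normrM.
  rewrite (_ : _ * (sin y * pi * q) = n%:R * sin y * (pi * (r ^+ n.-1 * q))); last by ring.
  apply: ler_pM => //; first exact: norm_sin_natmul_le.
  have /andP[h1 h2] := psi_rest_bounds n0 x0 xpi; have := qn n n0.
  have : 0 <= sinh (n%:R * x) / sinh (n%:R * pi) ^+ 2.
    by rewrite divr_ge0 ?sqr_ge0// sinh_ge0// mulr_ge0.
  move: (_ / _) h1 h2 => u h1 h2 u0 ur.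
  have piu : pi * u <= pi * (r ^+ n.-1 * q) by apply: ler_wpM2l => //; lra.
  rewrite ler_norml; apply/andP; split; first by lra.
  by have := mulr_ge0 (pi_ge0 R) u0; lra.
have /andP[h1 h2] := psi_rest_bounds (ltn0Sn 0) x0 xpi.
move: h1 h2; rewrite !mul1r -/s -/q => h1 h2.
have h3 : sin y * psi_rest 1 x <= sin y * - (pi / 4 * q) by rewrite ler_wpM2l.
have h4 : sin y * - (pi * q) <= sin y * psi_rest 1 x by rewrite ler_wpM2l.
have yq : sin y * pi * q <= 7 / 16.
  have : pi * q <= 7 / 16.
    apply: le_trans (_ : pi * s^-1 <= _); first by rewrite ler_wpM2l// pi_ge0.
    by rewrite ler_pdivrMr//; have := sinh_pi_ge R; rewrite -/s; lra.
  have pq0 : 0 <= pi * q := mulr_ge0 (pi_ge0 R) q0.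
  have := sin_le1 y; rewrite -mulrA; move: (pi * q) pq0 => u u0; nra.
move: tail; rewrite ler_norml => /andP[t1 t2].
apply/andP; split; lra.
Qed.

(** Combine x sin(y) <= (x^2 + sin(y)^2)/2 with cosh(x) >= 1 + x^2/2 and sin(y)^2/2 <= 1 -
    cos(y). *)
Lemma sin_cosh_le (x y : R) : 0 <= x -> x * sin y <= cosh x - cos y.
Proof.
move=> x0; have := cosh_ge_quadratic x0; have := cos2Dsin2 y.
have := sqr_ge0 (x - sin y); have := sqr_ge0 (1 - cos y).
by move: (sin y) (cos y) (cosh x) => u v w; nra.
Qed.

(* Imaginary part of the geometric sum of [r e^{iy}], cleared of its
   denominator [|1 - r e^{iy}|^2]. *)
Lemma geometric_sin_sum N (r y : R) :
  (1 - 2 * r * cos y + r ^+ 2) * \sum_(1 <= n < N.+1) r ^+ n * sin (n%:R * y) =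
  r * sin y - r ^+ N.+1 * sin (N.+1%:R * y) + r ^+ N.+2 * sin (N%:R * y).
Proof.
elim: N => [|N IH]; first by rewrite big_geq// mul0r sin0 mul1r !mulr0 expr1; ring.
rewrite big_nat_recr//= mulrDr IH.
have E : sin (N%:R * y) + sin (N.+2%:R * y) = 2 * cos y * sin (N.+1%:R * y).
  have -> : N%:R * y = N.+1%:R * y - y by rewrite -natr1; ring.
  have -> : N.+2%:R * y = N.+1%:R * y + y by rewrite -[N.+2%:R]natr1; ring.
  by rewrite sinB sinD; ring.
have -> : sin (N.+2%:R * y) = 2 * cos y * sin (N.+1%:R * y) - sin (N%:R * y).
  by rewrite -E; ring.
by rewrite !exprS; ring.
Qed.

(** The geometric sum splits into x sin(y) / (2 (cosh(x) - cos(y))), which [sin_cosh_le] bounds by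
    1/2, and a remainder with the factor r^N. The denominator [D] is at least (1 - e^(-c))^2, so the
    error is uniform in [x] and [y]. *)
Lemma psi_main_bounds N (c x y : R) : 0 < c -> c <= x -> x <= pi -> 0 <= y <= pi ->
  let err := 2 * pi / ((1 - expR (- c)) ^+ 2 * (1 + N%:R * c)) in
  - err <= \sum_(1 <= n < N.+1) sin (n%:R * y) * (x * expR (- x) ^+ n) <= 2^-1 + err.
Proof.
move=> c0 cx xpi ypi; set err := (X in let _ := X in _) => /=.
have x0 : 0 < x by exact: lt_le_trans cx.
have sy := sin_ge0_pi ypi.
set r := expR (- x).
have r0 : 0 < r by exact: expR_gt0.
have rc : r <= expR (- c) by rewrite ler_expR lerN2.
have rc1 : expR (- c) < 1 by rewrite -expR0 ltr_expR; lra.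
pose D := 1 - 2 * r * cos y + r ^+ 2.
have DE : D = 2 * r * (cosh x - cos y).
  rewrite /D /cosh -[x in expR x]opprK [expR (- - _)]expRN -/r; field.
  by rewrite gt_eqF.
have Dge : (1 - expR (- c)) ^+ 2 <= D.
  apply: le_trans (_ : (1 - r) ^+ 2 <= _).
    by rewrite ler_pXn2r ?nnegrE//; lra.
  by rewrite /D; have := cos_le1 y; nra.
have c1 : 0 < (1 - expR (- c)) ^+ 2 by rewrite exprn_gt0//; lra.
have D0 : 0 < D by exact: lt_le_trans Dge.
have -> : \sum_(1 <= n < N.+1) sin (n%:R * y) * (x * r ^+ n) =
  x * (r * sin y) / D + x * (r ^+ N.+2 * sin (N%:R * y) - r ^+ N.+1 * sin (N.+1%:R * y)) / D.
  transitivity (x * \sum_(1 <= n < N.+1) r ^+ n * sin (n%:R * y)).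
    by rewrite mulr_sumr; apply: eq_big_nat => n _; ring.
  apply: (mulfI (lt0r_neq0 D0)); rewrite mulrCA geometric_sin_sum.
  by field; rewrite gt_eqF.
have main0 : 0 <= x * (r * sin y) / D.
  by rewrite divr_ge0 ?(ltW D0)// !mulr_ge0// ltW.
have main1 : x * (r * sin y) / D <= 2^-1.
  rewrite ler_pdivrMr// DE; have := sin_cosh_le y (ltW x0).
  by move: (cosh x - cos y) => w; nra.
have rN : r ^+ N <= (1 + N%:R * c)^-1.
  apply: le_trans (_ : expR (- c) ^+ N <= _).
    by rewrite lerXn2r ?nnegrE// ltW// expR_gt0.
  rewrite -expRM_natl mulrN expRN lef_pV2 ?posrE ?expR_gt0 ?expR_ge1Dx//.
  by rewrite ltr_wpDr// mulr_ge0// ltW.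
have Nc0 : 0 < 1 + N%:R * c by rewrite ltr_wpDr// mulr_ge0// ltW.
have r1 : r <= 1 by lra.
have errb : `|x * (r ^+ N.+2 * sin (N%:R * y) - r ^+ N.+1 * sin (N.+1%:R * y)) / D| <= err.
  rewrite normrM [X in _ * X]gtr0_norm ?invr_gt0//.
  rewrite (_ : err = 2 * pi / (1 + N%:R * c) * ((1 - expR (- c)) ^+ 2)^-1); last first.
    by rewrite /err invfM; ring.
  have DV : D^-1 <= ((1 - expR (- c)) ^+ 2)^-1 by rewrite lef_pV2.
  apply: ler_pM DV => //; first by rewrite invr_ge0 ltW.
  apply: le_trans (_ : pi * (2 * r ^+ N) <= _); last first.
    by rewrite mulrA [pi * 2]mulrC; apply: ler_wpM2l => //; exact: mulr_ge0 (pi_ge0 R).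
  rewrite normrM (gtr0_norm x0) ler_pM ?(ltW x0)//.
  apply: le_trans (ler_normB _ _) _; rewrite [leRHS]mulr_natl mulr2n.
  have rNN k z : (N <= k)%N -> `|r ^+ k * sin z| <= r ^+ N.
    move=> Nk; rewrite normrM -[leRHS]mulr1 ler_pM//.
      by rewrite normrX (gtr0_norm r0) ler_wiXn2l// ltW.
    by rewrite ler_norml sin_geN1 sin_le1.
  by rewrite lerD// rNN// -addn2 leq_addr.
move: errb; rewrite ler_norml => /andP[e1 e2].
apply/andP; split; lra.
Qed.

(** The main part lies in [0, 1/2] up to the error and the remainder in [-1/2, 0], so the two
    half-bounds do not add up. *)
Lemma psi_sum_bound (c e : R) : 0 < c -> 0 < e ->
  exists N0, forall N, (N0 <= N)%N -> forall x y, c <= x <= pi -> 0 <= y <= pi ->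
  `|\sum_(1 <= n < N.+1) sin (n%:R * y) * psi n%:R x| <= 2^-1 + e.
Proof.
move=> c0 e0; have rc1 : expR (- c) < 1 by rewrite -expR0 ltr_expR; lra.
have pi0 := pi_gt0 R.
pose d := (1 - expR (- c)) ^+ 2; have d0 : 0 < d by rewrite exprn_gt0//; lra.
pose K := 2 * pi / (d * c * e).
have K0 : 0 < K by apply: divr_gt0; apply: mulr_gt0 => //; apply: mulr_gt0.
exists (Num.bound K) => N NK x y /andP[cx xpi] ypi.
have KN : K <= N%:R.
  have : (Num.bound K)%:R <= N%:R :> R by rewrite ler_nat.
  by have := archi_boundP (ltW K0); lra.
have Nc0 : 0 < 1 + N%:R * c by rewrite ltr_wpDr// mulr_ge0// ltW.
have := psi_main_bounds N c0 cx xpi ypi; rewrite /= -/d.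
have err_le : 2 * pi / (d * (1 + N%:R * c)) <= e.
  rewrite (ler_pdivrMr _ _ (mulr_gt0 d0 Nc0)).
  move: KN; rewrite /K (ler_pdivrMr _ _ (mulr_gt0 (mulr_gt0 d0 c0) e0)) => h.
  have := mulr_gt0 e0 d0.
  have -> : e * (d * (1 + N%:R * c)) = e * d + N%:R * (d * c * e) by ring.
  lra.
have x0 : 0 <= x by lra.
have := psi_rest_sum_bounds N x0 xpi ypi => /andP[r1 r2] /andP[m1 m2].
under eq_bigr do rewrite psiE mulrDr.
rewrite big_split/= ler_norml; apply/andP; split; lra.
Qed.

End PsiSum.

(** * The two forms of the series *)

Section SineForm.
Variable R : realType.

Definition apply_signs (a : nat * nat) (s : bool * bool) : int * int :=
  ((-1) ^+ s.1 * a.1%:Z, (-1) ^+ s.2 * a.2%:Z).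

Definition signs : seq (bool * bool) :=
  [:: (false, false); (false, true); (true, false); (true, true)].

Lemma mem_signs s : s \in signs.
Proof. by case: s => [[] []]. Qed.

Definition signed_pairs (A : {fset nat * nat}) : {fset int * int} :=
  [fset z in [seq apply_signs a s | a <- A, s <- signs]]%fset.

Lemma signed_pairsP A z :
  reflect (exists2 p, p.1 \in A & z = apply_signs p.1 p.2) (z \in signed_pairs A).
Proof.
rewrite inE; apply: (iffP allpairsP) => [[p [pA _ zE]]|[p pA zE]]; exists p => //.
by split=> //; exact: mem_signs.
Qed.

Lemma apply_signs_inj a b s t : (0 < a.1)%N -> (0 < a.2)%N ->
  apply_signs a s = apply_signs b t -> (a, s) = (b, t).
Proof.
case: a b s t => [a1 a2] [b1 b2] [s1 s2] [t1 t2]; rewrite /apply_signs /= => a10 a20 [].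
by case: s1 t1 s2 t2 => [] [] [] []; rewrite ?(expr0, expr1, mul1r, mulN1r) => e1 e2;
  do 2?congr (_, _); lia.
Qed.

(** Indices with a zero coordinate contribute 0. The four sign changes of (m, n) combine to -2 K
    (cos(X + Y) - cos(X - Y)) = 4 K sin(X) sin(Y), and the imaginary parts cancel. *)
Lemma exp_partial_sum_signed A (t : R * R) :
  exp_partial_sum (signed_pairs A) t = (sin_partial_sum A t)%:C.
Proof.
rewrite /exp_partial_sum /sin_partial_sum.
set f := fun m : int * int =>
  ((m.1%:~R * m.2%:~R) / (pi * (m.1%:~R ^+ 2 + m.2%:~R ^+ 2) ^+ 2))%:C
      * expi (m.1%:~R * t.1 + m.2%:~R * t.2) : R[i].
have -> : \sum_(m <- signed_pairs A | m != (0, 0)) f m =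
          \sum_(m <- signed_pairs A | (m.1 != 0) && (m.2 != 0)) f m.
  rewrite big_mkcond [RHS]big_mkcond; apply: eq_bigr => -[m1 m2] _ /=.
  case: ifPn => [_|]; last by rewrite negbK => /eqP[-> ->].
  case: ifPn => //; rewrite negb_and !negbK => /orP[] /eqP ->;
    by rewrite /f /= !(mul0r, mulr0, rmorph0).
rewrite -big_filter.
rewrite (perm_big [seq apply_signs a s |
  a <- [seq a <- A | (0 < a.1)%N && (0 < a.2)%N], s <- signs]).
  rewrite big_allpairs_dep big_filter /=.
  rewrite rmorphM rmorph_sum/= mulr_sumr -sumrN; apply: eq_bigr => -[m n] /= /andP[m0 n0].
  pose K := m%:R * n%:R / (pi * (m%:R ^+ 2 + n%:R ^+ 2) ^+ 2) : R.
  pose X := m%:R * t.1 : R; pose Y := n%:R * t.2 : R.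
  have fE (b c : bool) : f (apply_signs (m, n) (b, c)) =
      ((-1) ^+ b * (-1) ^+ c * K)%:C * expi ((-1) ^+ b * X + (-1) ^+ c * Y).
    rewrite /f /apply_signs /= !intrM !rmorph_sign !exprMn !sqrr_sign !mul1r -!pmulrn.
    by congr (_%:C * expi _); rewrite /K /X /Y; ring.
  rewrite !big_cons big_nil !fE /= !(expr0, expr1, mul1r, mulN1r) opprK addr0.
  have pi0 : pi != 0 :> R by rewrite gt_eqF// pi_gt0.
  have D0 : m%:R ^+ 2 + n%:R ^+ 2 != 0 :> R.
    by rewrite gt_eqF// addr_gt0// exprn_gt0// ltr0n.
  have -> : (m%:R * n%:R) / (m%:R ^+ 2 + n%:R ^+ 2) ^+ 2 = K * pi :> R.
    by rewrite /K; move: pi pi0 (_ + _) D0 => p p0 D D0; field; rewrite D0 p0.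
  rewrite -/X -/Y -rmorphM /= /expi sinD cosD sinB cosB -opprD cosN sinN.
  rewrite [- X + Y]addrC cosB sinB cosD sinD.
  apply/eqP; rewrite eq_complex /=; apply/andP; split; apply/eqP; last by ring.
  by move: pi pi0 => p p0; field.
apply: uniq_perm.
- by rewrite filter_uniq// fset_uniq.
- apply: allpairs_uniq => //; first by rewrite filter_uniq// fset_uniq.
  move=> [a s] [b u] /allpairsP[[a' s'] /= [+ _ [-> ->]]] _ /=.
  rewrite mem_filter => /andP[/andP[h1 h2] _]; exact: apply_signs_inj.
move=> z; rewrite mem_filter; apply/andP/allpairsP.
  move=> [/andP[z1 z2] /signed_pairsP[[a s] /= aA zE]].
  exists (a, s) => /=; split=> //; last exact: mem_signs.
  by rewrite mem_filter aA andbT; move: z1 z2; rewrite zE !mulf_eq0 !signr_eq0 /=; lia.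
move=> [[a s] /= [+ sS zE]].
rewrite mem_filter => /andP[/andP[h1 h2] aA]; split.
  by rewrite zE !mulf_eq0 !signr_eq0 /=; lia.
by apply/signed_pairsP; exists (a, s).
Qed.

(** Sign-symmetric sets are cofinal: a finite set [B] lies in [signed_pairs A] as soon as [A]
    contains the absolute values of its elements. *)
Lemma signed_pairs_cvg : signed_pairs A @[A --> totally] --> totally.
Proof.
move=> P [B _ BP]; exists [fset (`|z.1|%N, `|z.2|%N) | z in B]%fset => // A /= BA.
apply: BP => /=; apply/fsubsetP => z zB; apply/signed_pairsP.
exists ((`|z.1|%N, `|z.2|%N), (z.1 < 0, z.2 < 0)) => /=.
  by apply: (fsubsetP BA); apply/imfsetP; exists z.
by case: (z) => z1 z2; rewrite /apply_signs /= -!intEsign.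
Qed.

Lemma sin_partial_sum_L2 (f : R * R -> R[i]) :
  L2_sums_to (@exp_partial_sum R) f ->
  L2_sums_to (fun A t => (sin_partial_sum A t)%:C) f.
Proof.
rewrite /L2_sums_to => h.
rewrite (_ : (fun A => _) =
  (fun A => L2dist (@exp_partial_sum R A) f) \o signed_pairs); last first.
  apply/funext => A /=; congr L2dist; apply/funext => t.
  by rewrite exp_partial_sum_signed.
exact: cvg_comp signed_pairs_cvg h.
Qed.

Definition rectangle (M N : nat) : {fset nat * nat} :=
  [fset p in [seq (m, n) | m <- iota 0 M.+1, n <- iota 0 N.+1]]%fset.

Lemma mem_rectangle M N p :
  (p \in rectangle M N) = (p.1 <= M)%N && (p.2 <= N)%N.
Proof.
rewrite in_fset; apply/idP/andP => [/allpairsP[[m n] [+ + ->]]|[p1 p2]].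
  by rewrite !mem_iota/= !ltnS => -> ->.
by apply/allpairsP; exists p; rewrite !mem_iota/= !ltnS; split=> //; case: p {p1 p2}.
Qed.

(** The sides may grow independently, so [M] can be chosen after [N]. *)
Lemma fsubset_rectangle (A : {fset nat * nat}) :
  exists K, forall M N, (K <= M)%N -> (K <= N)%N -> (A `<=` rectangle M N)%fset.
Proof.
exists (\max_(p <- A) maxn p.1 p.2) => M N KM KN; apply/fsubsetP => p pA.
have : (maxn p.1 p.2 <= \max_(p <- A) maxn p.1 p.2)%N by exact: leq_bigmax_seq.
rewrite geq_max mem_rectangle => /andP[h1 h2].
by rewrite (leq_trans h1)// (leq_trans h2).
Qed.

Lemma sin_partial_sum_rectangle M N (t : R * R) :
  sin_partial_sum (rectangle M N) t = 4 / pi *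
    \sum_(1 <= n < N.+1) n%:R * sin (n%:R * t.2) * square_resolvent_sum n%:R M t.1.
Proof.
rewrite /sin_partial_sum -big_filter.
rewrite (perm_big [seq (m, n) | m <- index_iota 1 M.+1, n <- index_iota 1 N.+1]).
  rewrite big_allpairs_dep exchange_big /=; congr (_ * _).
  by apply: eq_bigr => n _; rewrite mulr_sumr; apply: eq_bigr => m _ /=; ring.
apply: uniq_perm.
- by rewrite filter_uniq// fset_uniq.
- by apply: allpairs_uniq; rewrite ?iota_uniq// => -[? ?] [? ?].
move=> [m n]; rewrite mem_filter mem_rectangle /=.
apply/idP/allpairsP => [h|[[m' n'] /= [+ + [-> ->]]]].
  by exists (m, n); rewrite !mem_index_iota /=; split=> //; lia.
by rewrite !mem_index_iota; lia.
Qed.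

End SineForm.

(** * The bound on the L2 limit *)

Section RectangularSums.
Variable R : realType.

(** For fixed [N] only finitely many inner sums are involved; the induction spends half of [e] on
    the last one. The factor 4 n / pi cancels the pi / (4 n) of the inner limit. *)
Lemma rectangular_sum_tends N (e : R) : 0 < e ->
  exists M0, forall M, (M0 <= M)%N -> forall x y, 0 <= x <= pi ->
  `|4 / pi * \sum_(1 <= n < N.+1) n%:R * sin (n%:R * y) * square_resolvent_sum n%:R M x
    - \sum_(1 <= n < N.+1) sin (n%:R * y) * psi n%:R x| <= e.
Proof.
have pi0 := pi_gt0 R.
elim: N e => [|N IH] e e0.
  by exists 0%N => M _ x y _; rewrite !big_geq// mulr0 subr0 normr0 ltW.
have e2 : 0 < e / 2 by rewrite divr_gt0.
have [M1 h1] := IH _ e2.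
have n0 : 0 < N.+1%:R :> R by [].
have k0 : 0 < 4 * N.+1%:R / pi :> R by rewrite divr_gt0// mulr_gt0.
have [M2 h2] := square_resolvent_uniformly_tends n0 (divr_gt0 e2 k0).
exists (maxn M1 M2) => M; rewrite geq_max => /andP[MM1 MM2] x y xI.
have {}h1 := h1 M MM1 x y xI; have {}h2 := h2 M MM2 x xI.
rewrite !(big_nat_recr N.+1)//= mulrDr opprD addrACA.
apply: le_trans (ler_normD _ _) _; rewrite [leRHS]splitr; apply: lerD => //.
rewrite [X in `|X|](_ : _ = sin (N.+1%:R * y) * (4 * N.+1%:R / pi *
    (square_resolvent_sum N.+1%:R M x - pi / (4 * N.+1%:R) * psi N.+1%:R x))); last first.
  by move: (pi) pi0 (N.+1%:R) n0 => p p0 n n0; field; rewrite !gt_eqF.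
rewrite normrM -[leRHS]mul1r ler_pM//; first by rewrite ler_norml sin_geN1 sin_le1.
by rewrite normrM gtr0_norm// mulrC -ler_pdivlMr.
Qed.

(** The sums are odd in each variable, which reduces the bounds to the quadrant where both
    coordinates are nonnegative. *)
Lemma norm_sin_partial_sum A (t : R * R) :
  `|sin_partial_sum A t| = `|sin_partial_sum A (`|t.1|, `|t.2|)|.
Proof.
case: t => x y /=.
have hx u v : sin_partial_sum A (- u, v) = - sin_partial_sum A (u, v) :> R.
  rewrite /sin_partial_sum -mulrN -sumrN; congr (_ * _); apply: eq_bigr => m _ /=.
  by rewrite mulrN sinN; ring.
have hy u v : sin_partial_sum A (u, - v) = - sin_partial_sum A (u, v) :> R.
  rewrite /sin_partial_sum -mulrN -sumrN; congr (_ * _); apply: eq_bigr => m _ /=.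
  by rewrite mulrN sinN; ring.
by case: (ler0P x) => _; case: (ler0P y) => _; rewrite ?(hx, hy) ?normrN.
Qed.

(** [M0] depends on [N] because the limit in m is taken for a fixed range of n. *)
Lemma rectangular_sum_bound (c e : R) : 0 < c -> 0 < e ->
  exists N0, forall N, (N0 <= N)%N -> exists M0, forall M, (M0 <= M)%N ->
  forall t : R * R, c <= `|t.1| <= pi -> `|t.2| <= pi ->
  `|sin_partial_sum (rectangle M N) t| <= 2^-1 + e.
Proof.
move=> c0 e0; have e2 : 0 < e / 2 by rewrite divr_gt0.
have [N0 hN0] := psi_sum_bound c0 e2.
exists N0 => N /hN0 hN; have [M0 hM0] := rectangular_sum_tends N e2.
exists M0 => M /hM0 hM t t1 t2.
rewrite norm_sin_partial_sum sin_partial_sum_rectangle /=.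
have t20 : 0 <= `|t.2| <= pi by rewrite normr_ge0.
have t10 : 0 <= `|t.1| <= pi by rewrite normr_ge0; case/andP: t1.
have h1 := hN _ _ t1 t20; have h2 := hM `|t.1| `|t.2| t10.
move: h1 h2; set S := 4 / pi * _; set T := \sum_(_ <= _ < _) _ => h1 h2.
rewrite -(subrK T S); apply: le_trans (ler_normD _ _) _.
by lra.
Qed.

End RectangularSums.

(** * Lower bounds for the L2 distance *)

Section LowerBound.
Local Open Scope ereal_scope.

(* [ge0_le_integral] asks for [f] to be measurable, which is unknown for the
   function [F] of the theorem. *)
Lemma integral_ge_indic d (T : measurableType d) (R : realType)
    (mu : {measure set T -> \bar R}) (A : set T) (k : R) (f : T -> \bar R) :
  measurable A -> (0 <= k)%R -> (forall x, 0 <= f x) ->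
  (forall x, A x -> k%:E <= f x) -> k%:E * mu A <= \int[mu]_x f x.
Proof.
move=> mA k0 f0 kf; rewrite ge0_integralTE//; apply: ereal_sup_ubound.
(* The integral is a supremum over simple functions below [f], and [k] times the indicator of [A] is
   one of them. *)
exists (scale_nnsfun (indic_nnsfun R mA) k0) => [x|].
  change ((k * \1_A x)%:E <= f x); rewrite indicE.
  have [/set_mem xA|_] := boolP (x \in A).
    by rewrite mulr1 kf.
  by rewrite mulr0.
by rewrite -[mu A]sintegral_indic; exact: (sintegralrM mu k (indic_nnsfun R mA)).
Qed.

(** A Chebyshev-type bound: a gap of [e] on a box costs [e ^+ 2] times its area. *)
Lemma L2dist_sqr_ge (R : realType) (f g : R * R -> R[i]) (a1 b1 a2 b2 e : R) :
  (a1 < b1)%R -> (a2 < b2)%R -> (0 <= e)%R ->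
  (forall t, (a1 <= t.1 <= b1)%R -> (a2 <= t.2 <= b2)%R ->
    square R t /\ (e <= ComplexField.Normc.normc (f t - g t))%R) ->
  (e ^+ 2 * ((b1 - a1) * (b2 - a2)))%:E <= L2dist f g `^ 2.
Proof.
move=> ab1 ab2 e0 h; rewrite /L2dist poweR_Lnorm//.
have itvE a b : (a < b)%R -> lebesgue_measure (`[a, b] : set R) = (b - a)%:E.
  by move=> ab; rewrite lebesgue_measure_itv/= lte_fin ab.
have mE : (lebesgue2 R) (`[a1, b1] `*` `[a2, b2]) = ((b1 - a1) * (b2 - a2))%:E.
  apply: (etrans (product_measure1E _ _ _ _)); [exact: measurable_itv..|].
  by rewrite EFinM; congr (_ * _); exact: itvE.
rewrite EFinM -mE; apply: integral_ge_indic.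
- by apply: measurableX; exact: measurable_itv.
- exact: sqr_ge0.
- by move=> x; exact: poweR_ge0.
move=> t [/=]; rewrite !in_itv/= => t1 t2; have [st et] := h t t1 t2.
rewrite patchE mem_set//= lee_fin powR_mulrn// lerXn2r ?nnegrE//.
by rewrite (le_trans et)// ler_norm.
Qed.

End LowerBound.

(** * From the partial sums to the continuous representative *)

Section Bound.
Variable R : realType.

(** The interval is placed on the side of [x0] towards 0, so it stays in [-pi, pi] even when [x0] is
    an endpoint; for [x0 = 0] it is placed to the right. *)
Lemma subinterval_away_from0 (x0 r : R) : - pi <= x0 <= pi -> 0 < r ->
  exists a b c, [/\ a < b, 0 < c & forall x, a <= x <= b ->
    `|x0 - x| < r /\ c <= `|x| <= pi].
Proof.
move=> /andP[x0a x0b] r0; have pi2 := pi_ge2 R.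
have [x00|x00|x00] := ltgtP x0 0.
- pose e := Num.min r (- x0) / 2.
  have e0 : 0 < e by rewrite divr_gt0// lt_min r0; lra.
  have er : e <= r / 2 by rewrite ler_pM2r// ge_min lexx.
  have ex : e <= - x0 / 2 by rewrite ler_pM2r// ge_min lexx orbT.
  exists (x0 + e / 2), (x0 + e), (- x0 / 2); split; [lra|lra|].
  by move=> x /andP[h1 h2]; rewrite (@ltr0_norm _ x) ?ltr_distl; [lra|lra].
- pose e := Num.min r x0 / 2.
  have e0 : 0 < e by rewrite divr_gt0// lt_min r0; lra.
  have er : e <= r / 2 by rewrite ler_pM2r// ge_min lexx.
  have ex : e <= x0 / 2 by rewrite ler_pM2r// ge_min lexx orbT.
  exists (x0 - e), (x0 - e / 2), (x0 / 2); split; [lra|lra|].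
  by move=> x /andP[h1 h2]; rewrite (@gtr0_norm _ x) ?ltr_distl; [lra|lra].
pose e := Num.min r 1 / 2.
have e0 : 0 < e by rewrite divr_gt0// lt_min r0; lra.
have er : e <= r / 2 by rewrite ler_pM2r// ge_min lexx.
have ex : e <= 1 / 2 by rewrite ler_pM2r// ge_min lexx orbT.
exists (e / 2), e, (e / 2); split; [lra|lra|].
by move=> x /andP[h1 h2]; rewrite (@gtr0_norm _ x) ?ltr_distl; [lra|lra].
Qed.

Lemma continuous_representative_bound (F : R * R -> R) (t : R * R) :
  L2_sums_to (fun A u => (sin_partial_sum A u)%:C) (fun u => (F u)%:C) ->
  {within square R `\ (0, 0), continuous F} ->
  square R t -> t <> (0, 0) -> `|F t| <= 2^-1.
Proof.
move=> FL2 cF st t0; rewrite leNgt; apply/negP => Ft.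
(* A third of the excess: near [t], |F| stays above 1/2 + 2e while the partial sums stay below 1/2 +
   e, which leaves a gap of [e]. *)
pose e := (`|F t| - 2^-1) / 3.
have e0 : 0 < e by rewrite divr_gt0// subr_gt0.
have /nbhs_ballP[r /= r0 rF] : \forall u \near t,
    (square R `\ (0, 0)) u -> `|F t - F u| < e.
  have /subspace_continuousP := cF => /(_ t (conj st t0)).
  by move=> /cvgrPdist_lt /(_ e e0).
have [st1 st2] := st; move: st1 st2; rewrite /= !in_itv/= => st1 st2.
have [a1 [b1 [c1 [ab1 c10 h1]]]] := subinterval_away_from0 st1 r0.
have [a2 [b2 [c2 [ab2 c20 h2]]]] := subinterval_away_from0 st2 r0.
pose k := e ^+ 2 * ((b1 - a1) * (b2 - a2)).
have k0 : 0 < k by rewrite mulr_gt0 ?exprn_gt0// mulr_gt0// subr_gt0.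
(* [k] bounds the squared distance from below; since [eta <= 1], its square is at most k/2. *)
pose eta := Num.min 1 (k / 2).
have eta0 : 0 < eta by rewrite lt_min ltr01 divr_gt0.
have etak : eta ^+ 2 < k.
  have h3 : eta <= 1 by rewrite ge_min lexx.
  have h4 : eta <= k / 2 by rewrite ge_min lexx orbT.
  by nra.
have nbhs_eta : nbhs (0%E : \bar R) [set x | (x < eta%:E)%E].
  apply: open_nbhs_nbhs; split; first exact: open_ereal_lt_ereal.
  by rewrite /= lte_fin.
have [A0 _ hA0] := FL2 _ nbhs_eta.
have [K hK] := fsubset_rectangle A0.
have [N0 hN0] := rectangular_sum_bound c10 e0.
(* [N] is fixed first and [M] afterwards, both at least [K], so that one rectangle contains [A0] and
   also satisfies the uniform bound. *)
have [M0 hM0] := hN0 (maxn K N0) (leq_maxr _ _).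
have S_le := hM0 (maxn K M0) (leq_maxr _ _).
have /hA0 /= : (A0 `<=` rectangle (maxn K M0) (maxn K N0))%fset.
  by apply: hK; exact: leq_maxl.
apply/negP; rewrite -leNgt leNgt; apply/negP => Llt.
have : (L2dist (fun u => (sin_partial_sum (rectangle (maxn K M0) (maxn K N0)) u)%:C)
   (fun u => (F u)%:C) `^ 2 <= eta%:E `^ 2)%E.
  apply: gt0_ler_poweR => //; rewrite ?in_itv/= ?leey ?andbT ?lee_fin//; last exact: ltW.
  - exact: Lnorm_ge0.
  - exact: ltW.
apply/negP; rewrite -ltNge poweR_EFin powR_mulrn ?(ltW eta0)//.
apply: lt_le_trans (_ : k%:E <= _)%E; first by rewrite lte_fin.
apply: L2dist_sqr_ge ab1 ab2 (ltW e0) _ => u u1 u2.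
have [d1 /andP[m1 n1]] := h1 u.1 u1; have [d2 /andP[m2 n2]] := h2 u.2 u2.
have su : square R u by split; rewrite /= in_itv/= -ler_norml.
split=> //.
have u0 : u <> (0, 0) by move=> uE; move: m1; rewrite uE /= normr0; lra.
have Fu := rF u (conj d1 d2) (conj su u0).
have Su : `|sin_partial_sum (rectangle (maxn K M0) (maxn K N0)) u| <= 2^-1 + e.
  by apply: S_le => //; rewrite m1.
rewrite -rmorphB /= expr0n addr0 sqrtr_sqr.
have h3 : `|F t| <= `|F t - F u| + `|F u| by rewrite -{1}(subrK (F u) (F t)) ler_normD.
have h4 := lerB_dist (F u) (sin_partial_sum (rectangle (maxn K M0) (maxn K N0)) u).
have : e = (`|F t| - 2^-1) / 3 by [].
by rewrite distrC; lra.
Qed.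

End Bound.

Unset Implicit Arguments.

Theorem lemma3p6 (R : realType) (F : R * R -> R)
    (HF : continuous_representative F) :
  L2_sums_to (fun A t => (sin_partial_sum A t)%:C) (fun t => (F t)%:C) /\
  (forall t : R * R, square R t -> F t \in `[- (1 / 2), 1 / 2]).
Proof.
have [FL2 cF F0] := HF; have sinL2 := sin_partial_sum_L2 FL2; split=> // t st.
rewrite in_itv /= mul1r -ler_norml; have [->|t0] := eqVneq t (0, 0).
  by rewrite F0 normr0.
by apply: continuous_representative_bound => //; exact/eqP.
Qed.
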